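(* Let $G$ be a graph and $G^2$ its square. If $G$ admits a straight-line drawing with ply $1$, then $G^2$ admits an empty-ply drawing. Moreover, if $G$ is a subgraph of the triangular tiling, then $G^2$ admits an empty-ply drawing with ply at most $4$.
   Context: The square $G^2$ of a graph $G$ is obtained from $G$ by adding an edge between every two distinct vertices at distance $2$ in $G$. The triangular tiling is the infinite plane graph formed by the vertices and edges of the tiling of the plane by congruent equilateral triangles. A straight-line drawing of a graph places each vertex at a distinct point of the plane and draws each edge as the straight-line segment between its endpoints (edges are allowed to overlap). For each vertex $v$, the ply-disk $D_v$ is the open disk centered at $v$ with radius equal to half the length of the longest edge incident to $v$. The ply of a drawing is the maximum, over all points $p$ of the plane, of the number of ply-disks containing $p$ in their interior. A drawing is empty-ply if every ply-disk $D_v$ contains no vertex other than $v$ in its interior. *)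

(* Defs.v *)
From HB Require Import structures.
From mathcomp Require Import all_boot all_order all_algebra.
From mathcomp Require Import ring lra zify.
From mathcomp Require Import mathcomp_extra boolp classical_sets cardinality reals.
Set Implicit Arguments.
Unset Strict Implicit.
Unset Printing Implicit Defensive.
Import Order.TTheory GRing.Theory Num.Theory.
Local Open Scope classical_set_scope.
Local Open Scope ring_scope.

Record sgraph (V : Type) := SGraph {
  adj : V -> V -> Prop;
  adj_sym : forall u v, adj u v -> adj v u;
  adj_irrefl : forall v, ~ adj v v }.

Fixpoint walk (V : Type) (G : sgraph V) (n : nat) (u v : V) : Prop :=
  if n is m.+1 then exists w, adj G u w /\ walk G m w v else u = v.

Definition at_distance (V : Type) (G : sgraph V) (n : nat) (u v : V) : Prop :=
  walk G n u v /\ forall m, (m < n)%N -> ~ walk G m u v.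

Definition square_adj (V : Type) (G : sgraph V) (u v : V) : Prop :=
  adj G u v \/ (u <> v /\ at_distance G 2 u v).

Lemma walk_rcons (V : Type) (G : sgraph V) n u v w :
  walk G n u v -> adj G v w -> walk G n.+1 u w.
Proof.
elim: n u => [u /= -> vw|n IH u /= [x [ux xv]] vw]; first by exists w.
by exists x; split=> //; exact: IH.
Qed.

Lemma walk_sym (V : Type) (G : sgraph V) n u v : walk G n u v -> walk G n v u.
Proof.
elim: n u => [u -> //|n IH u [x [ux xv]]].
exact: walk_rcons (IH _ xv) (adj_sym ux).
Qed.

Lemma square_adj_sym (V : Type) (G : sgraph V) u v :
  square_adj G u v -> square_adj G v u.
Proof.
case=> [uv|[uv [w2 min2]]]; first by left; exact: adj_sym.
right; split; first by move=> vu; apply: uv.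
split; first exact: walk_sym.
by move=> m mlt vu; apply: (min2 m mlt); exact: walk_sym.
Qed.

Lemma square_adj_irrefl (V : Type) (G : sgraph V) v : ~ square_adj G v v.
Proof. by case=> [vv|[]//]; exact: (@adj_irrefl V G v). Qed.

Definition square (V : Type) (G : sgraph V) : sgraph V :=
  SGraph (@square_adj_sym V G) (@square_adj_irrefl V G).

(* The library norm on R * R is the sup norm, hence this Euclidean distance. *)
Definition edist (R : realType) (p q : R * R) : R :=
  Num.sqrt ((p.1 - q.1) ^+ 2 + (p.2 - q.2) ^+ 2).

(* Edges are the segments determined by their endpoints and may overlap, so a
   straight-line drawing amounts to an injective placement of the vertices. *)
Definition drawing (R : realType) (V : Type) (d : V -> R * R) : Prop :=
  injective d.

Definition longest_edge (R : realType) (V : Type) (G : sgraph V)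
    (d : V -> R * R) (v : V) (l : R) : Prop :=
  (exists w, adj G v w /\ edist (d v) (d w) = l) /\
  (forall w, adj G v w -> edist (d v) (d w) <= l).

(* An isolated vertex has no longest edge; its disk is empty, as is an open disk
   of radius 0. *)
Definition ply_disk (R : realType) (V : Type) (G : sgraph V)
    (d : V -> R * R) (v : V) : set (R * R) :=
  [set p | exists l, longest_edge G d v l /\ edist (d v) p < l / 2].

Definition disks_at (R : realType) (V : Type) (G : sgraph V)
    (d : V -> R * R) (p : R * R) : set V :=
  [set v | ply_disk G d v p].

(* k is the maximum of #|disks_at G d p| over all points p of the plane. *)
Definition has_ply (R : realType) (V : Type) (G : sgraph V)
    (d : V -> R * R) (k : nat) : Prop :=
  (forall p, (disks_at G d p #<= `I_k)%card) /\
  (exists p, (disks_at G d p #= `I_k)%card).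

Definition empty_ply (R : realType) (V : Type) (G : sgraph V)
    (d : V -> R * R) : Prop :=
  forall v w, w <> v -> ~ ply_disk G d v (d w).

(* The triangular tiling: (a, b) stands for the point a (1, 0) + b (1/2, sqrt 3/2)
   of the tiling with side 1; tri_adjE checks that edges are the pairs at
   distance 1. *)
Definition tri_adj (x y : int * int) : bool :=
  (y.1 - x.1, y.2 - x.2) \in
  [:: (1, 0); (0, 1); (-1, 1); (-1, 0); (0, -1); (1, -1)].

Definition tri_pos (R : realType) (x : int * int) : R * R :=
  (x.1%:~R + x.2%:~R / 2, x.2%:~R * (Num.sqrt 3 / 2)).

Lemma tri_adjE (R : realType) (x y : int * int) :
  tri_adj x y <-> edist (tri_pos R x) (tri_pos R y) = 1.
Proof.
case: x y => [x1 x2] [y1 y2]; rewrite /tri_adj /edist /tri_pos /=.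
set a : int := y1 - x1; set b : int := y2 - x2.
have -> : (x1%:~R + x2%:~R / 2 - (y1%:~R + y2%:~R / 2)) ^+ 2 +
    (x2%:~R * (Num.sqrt 3 / 2) - y2%:~R * (Num.sqrt 3 / 2)) ^+ 2 =
    (a ^+ 2 + a * b + b ^+ 2)%:~R :> R.
  have s3 : Num.sqrt 3 ^+ 2 = 3 :> R by rewrite sqr_sqrtr.
  rewrite -mulrBl exprMn expr_div_n s3 /a /b.
  by rewrite !(intrD, intrM, rmorphXn, rmorphB) /=; field.
split=> [|h].
  by rewrite !inE => /or4P[|||/or3P[||]] /eqP[-> ->]; rewrite sqrtr1.
have : (a ^+ 2 + a * b + b ^+ 2)%:~R = 1%:~R :> R.
  rewrite -[LHS]sqr_sqrtr ?h ?expr1n // leNgt; apply/negP => /ltW/ler0_sqrtr h0.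
  by move: h; rewrite h0 => /esym/eqP; rewrite oner_eq0.
move=> /intr_inj {h}.
move: a b => a b h.
have ha : -1 <= a <= 1 by apply/andP; split; nia.
have hb : -1 <= b <= 1 by apply/andP; split; nia.
have [] : [\/ a = -1, a = 0 | a = 1].
- have : (a = -1) \/ (a = 0) \/ (a = 1) by lia.
  by case=> [|[]]; [constructor 1|constructor 2|constructor 3].
all: move=> ?; subst a.
all: have : (b = -1) \/ (b = 0) \/ (b = 1) by lia.
all: by case=> [|[]] ?; subst b.
Qed.

Lemma tri_adj_sym (x y : int * int) : tri_adj x y -> tri_adj y x.
Proof.
case: x y => [x1 x2] [y1 y2]; rewrite /tri_adj /= -(opprB y1) -(opprB y2) !inE.
by move=> /or4P[|||/or3P[||]] /eqP[-> ->].
Qed.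

Lemma tri_adj_irrefl (x : int * int) : ~ tri_adj x x.
Proof. by rewrite /tri_adj !subrr. Qed.

Definition triangular_tiling : sgraph (int * int) :=
  SGraph tri_adj_sym tri_adj_irrefl.

(* Up to isomorphism, and not necessarily induced. *)
Definition subgraph (V W : Type) (G : sgraph V) (H : sgraph W) : Prop :=
  exists f : V -> W,
    injective f /\ forall u v, adj G u v -> adj H (f u) (f v).

(* Main.v *)
Require Import Defs.
From mathcomp Require Import all_boot all_order all_algebra.
From mathcomp Require Import ring lra zify.
From mathcomp Require Import boolp classical_sets functions cardinality reals.
Set Implicit Arguments.
Unset Strict Implicit.
Unset Printing Implicit Defensive.
Import Order.TTheory GRing.Theory Num.Theory.
Local Open Scope classical_set_scope.
Local Open Scope ring_scope.

(** If the ply-disks of adjacent [u] and [v] are disjoint, each of radius at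
    least half of |uv|, then both radii equal |uv|/2.  Hence the edges of a
    component all have the same length l, and the disks of its vertices, being
    disjoint of radius l/2, keep their centers at distance at least l.  After
    rescaling the components to l = 1 and moving them apart, all vertices are at
    distance at least 1 from every non-isolated vertex, while edges of the square
    have length at most 2, so their disks have radius at most 1.  Components with
    the same l need not be separated, so the translation only depends on l.

    For the triangular tiling the drawing of the tiling itself works: two distinct
    lattice points that are congruent modulo 2 are at distance at least 2, hence
    an open disk of radius 1 contains at most one point of each of the four
    classes modulo 2. *)

(** * Cardinality bounds and attained maxima *)

Section Cardinality.

Lemma card_le_inj (T U : Type) (A : set T) (B : set U) (f : T -> U) :
  {in A &, injective f} -> (forall x, A x -> B (f x)) -> (A #<= B)%card.
Proof.
move=> f_inj fAB; rewrite -(card_le_eql (inj_card_eq f_inj)).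
by apply: subset_card_le => _ [x Ax <-]; exact: fAB.
Qed.

Lemma card_le_I1 (T : Type) (A : set T) (x y : T) :
  (A #<= `I_1)%card -> A x -> A y -> x = y.
Proof.
move=> /pcard_leP[f] Ax Ay; apply: ('inj_f); rewrite ?inE //.
have /= := 'funS_f Ax; have /= := 'funS_f Ay.
by case: (f x) (f y) => [|//] [].
Qed.

(** Supplies both the longest edge at a vertex and the constant that moves the classes of vertices
    apart. *)
Lemma finite_set_argmax (R : realType) (T : Type) (A : set T) (h : T -> R) :
  finite_set A -> A !=set0 -> exists2 x, A x & forall y, A y -> h y <= h x.
Proof.
elim/Pchoice: T => T in A h *.
move=> /finite_seqP[s ->]; elim: s => [[x]//|a s IH _].
have [/IH[x /= xs xmax]|s0] := pselect ([set` s] !=set0); last first.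
  exists a => [|y] /=; rewrite inE ?eqxx // => /orP[/eqP-> //|ys].
  by case: s0; exists y.
have [ax|/ltW xa] := leP (h a) (h x).
  exists x => [|y] /=; rewrite inE ?xs ?orbT // => /orP[/eqP-> //|].
  exact: xmax.
exists a => [|y] /=; rewrite inE ?eqxx // => /orP[/eqP-> //|ys].
by apply: le_trans xa; exact: xmax.
Qed.

(** The numbers of disks at the various points are naturals bounded by [n], so one of them is
    largest. *)
Lemma has_ply_le (R : realType) (V : Type) (G : sgraph V) (d : V -> R * R) n :
  (forall p, (disks_at G d p #<= `I_n)%card) ->
  exists2 k, (k <= n)%N & has_ply G d k.
Proof.
move=> le_n.
have card_disks p : exists2 k, (k <= n)%N & (disks_at G d p #= `I_k)%card.
  have [k pk] := card_le_finite (le_n p) (finite_II n).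
  by exists k => //; rewrite -card_le_II -(card_le_eql pk).
pose P k := `[< exists p, (disks_at G d p #= `I_k)%card >].
have exP : exists k, P k.
  by have [k _ pk] := card_disks (0, 0); exists k; apply/asboolP; exists (0, 0).
have P_le k : P k -> (k <= n)%N.
  by move=> /asboolP[p pk]; rewrite -card_le_II -(card_le_eql pk).
have [k /[dup] /P_le kn /asboolP Pk kmax] := ex_maxnP exP P_le.
exists k => //; split=> // p; have [j _ pj] := card_disks p.
by rewrite (card_le_eql pj) card_le_II; apply/kmax/asboolP; exists p.
Qed.

End Cardinality.

(** * Euclidean plane geometry *)

Section EuclideanDistance.
Variable R : realType.
Implicit Types p q r : R * R.

Lemma edist_ge0 p q : 0 <= edist p q.
Proof. exact: sqrtr_ge0. Qed.

Lemma edist_sqr p q : edist p q ^+ 2 = (p.1 - q.1) ^+ 2 + (p.2 - q.2) ^+ 2.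
Proof. by rewrite sqr_sqrtr // addr_ge0 ?sqr_ge0. Qed.

Lemma edistC p q : edist p q = edist q p.
Proof. by rewrite /edist -(opprB q.1) -(opprB q.2) !sqrrN. Qed.

Lemma edistxx p : edist p p = 0.
Proof. by rewrite /edist !subrr expr0n /= addr0 sqrtr0. Qed.

Lemma edist_gt0 p q : p <> q -> 0 < edist p q.
Proof.
case: p q => [p1 p2] [q1 q2] pq; rewrite lt_def edist_ge0 andbT.
apply/eqP => d0; apply: pq; have := edist_sqr (p1, p2) (q1, q2).
rewrite d0 expr0n /= => /esym/eqP; rewrite paddr_eq0 ?sqr_ge0 //.
by rewrite !sqrf_eq0 !subr_eq0 => /andP[/eqP-> /eqP->].
Qed.

Lemma edist_triangle p q r : edist p r <= edist p q + edist q r.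
Proof.
have := edist_sqr p q; have := edist_sqr q r; have := edist_sqr p r.
have := edist_ge0 p q; have := edist_ge0 q r; have := edist_ge0 p r.
move: (edist p q) (edist q r) (edist p r) => s t u u0 t0 s0 hu ht hs.
have [a ea] : exists a, a = p.1 - q.1 by exists (p.1 - q.1).
have [b eb] : exists b, b = p.2 - q.2 by exists (p.2 - q.2).
have [c ec] : exists c, c = q.1 - r.1 by exists (q.1 - r.1).
have [e ee] : exists e, e = q.2 - r.2 by exists (q.2 - r.2).
have {}hu : u ^+ 2 = (a + c) ^+ 2 + (b + e) ^+ 2.
  by rewrite hu ea eb ec ee; ring.
rewrite -ec -ee in ht; rewrite -ea -eb in hs.
(* Cauchy-Schwarz, from Lagrange's identity: the defect of the squares is [(a * e - b * c) ^+ 2]. *)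
have cs : a * c + b * e <= s * t.
  apply: (le_trans (ler_norm _)).
  rewrite -ler_sqr ?nnegrE ?mulr_ge0 // real_normK ?num_real // exprMn hs ht.
  by have := sqr_ge0 (a * e - b * c); lra.
by rewrite -ler_sqr ?nnegrE ?addr_ge0 //; nra.
Qed.

Lemma edist_affine (k a b : R) p q : 0 <= k ->
  edist (k * p.1 + a, k * p.2 + b) (k * q.1 + a, k * q.2 + b) = k * edist p q.
Proof.
move=> k0; rewrite -[k in RHS]ger0_norm // -sqrtr_sqr /edist -sqrtrM ?sqr_ge0 //.
by congr Num.sqrt => /=; ring.
Qed.

Lemma ge_edist1 p q : `|p.1 - q.1| <= edist p q.
Proof. by rewrite -sqrtr_sqr ler_wsqrtr // lerDl sqr_ge0. Qed.

(** The point dividing the segment from [p] to [q] in the ratio [a : b] lies in both disks. *)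
Lemma open_disks_meet p q (a b : R) : 0 < a -> 0 < b -> edist p q < a + b ->
  exists2 r, edist p r < a & edist q r < b.
Proof.
move=> a0 b0 pq; have ab0 : 0 < a + b by rewrite addr_gt0.
pose t := a / (a + b); pose u := b / (a + b).
have t0 : 0 < t by rewrite divr_gt0.
have u0 : 0 < u by rewrite divr_gt0.
have tu : u = 1 - t by rewrite /t /u; field; rewrite gt_eqF.
have ta : t * (a + b) = a by rewrite divfK ?gt_eqF.
have ub : u * (a + b) = b by rewrite divfK ?gt_eqF.
exists (t * q.1 + u * p.1, t * q.2 + u * p.2).
- rewrite [edist _ _](_ : _ = t * edist p q).
    by rewrite -[ltRHS]ta ltr_pM2l.
  rewrite -(@edist_affine _ (u * p.1) (u * p.2)) ?ltW //.
  by congr edist; case: (p) => x y /=; rewrite tu; congr pair; ring.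
- rewrite [edist _ _](_ : _ = u * edist q p).
    by rewrite -[ltRHS]ub ltr_pM2l // edistC.
  rewrite -(@edist_affine _ (t * q.1) (t * q.2)) ?ltW //.
  by congr edist; [case: (q) => x y /=|]; rewrite tu; congr pair; ring.
Qed.

End EuclideanDistance.

(** * Lengths of the edges of the square *)

Section SquareEdges.
Variables (R : realType) (V : Type) (G : sgraph V) (d : V -> R * R).

Lemma adj_neq u v : adj G u v -> u <> v.
Proof. by move=> uv eq_uv; apply: (@adj_irrefl _ G v); rewrite -{1}eq_uv. Qed.

Lemma square_adj_edist_le u v (l : R) :
  (forall x y, adj G x y -> edist (d x) (d y) <= l) ->
  square_adj G u v -> edist (d u) (d v) <= l + l.
Proof.
move=> le_l [uv|[_ [[w [uw [x [wx xv]]]] _]]].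
  by have := le_l _ _ uv; have := edist_ge0 (d u) (d v); lra.
rewrite -xv; apply: le_trans (edist_triangle _ (d w) _) _.
by rewrite lerD ?le_l.
Qed.

Lemma square_adj_neighbor u v : square_adj G u v -> exists w, adj G u w.
Proof. by case=> [uv|[_ [[w [uw _]] _]]]; [exists v|exists w]. Qed.

(** By the triangle inequality edges of the square have length at most 2, which bounds the radius by
    1. *)
Lemma square_ply_disk v p :
  (forall x y, adj G x y -> edist (d x) (d y) <= 1) ->
  ply_disk (square G) d v p -> edist (d v) p < 1 /\ exists w, adj G v w.
Proof.
move=> le1 [l [[[w [vw <-]] _] vp]]; split; last exact: square_adj_neighbor vw.
by have := square_adj_edist_le le1 vw; lra.
Qed.

End SquareEdges.

(** * Drawings with ply 1 *)

Section PlyOne.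
Variables (R : realType) (V : Type) (G : sgraph V) (d : V -> R * R).
Hypothesis d_inj : drawing d.
Hypothesis ply1 : has_ply G d 1.

Lemma longest_edge_gt0 v l : longest_edge G d v l -> 0 < l.
Proof.
move=> [[w [vw <-]] _]; apply: edist_gt0 => /d_inj.
exact: adj_neq vw.
Qed.

Lemma ply1_separated u v a b : u <> v ->
  longest_edge G d u a -> longest_edge G d v b -> (a + b) / 2 <= edist (d u) (d v).
Proof.
move=> uv ua vb; rewrite leNgt mulrDl; apply/negP => lt_ab; apply: uv.
have a0 := longest_edge_gt0 ua; have b0 := longest_edge_gt0 vb.
have [||r ur vr] := open_disks_meet _ _ lt_ab; rewrite ?divr_gt0 //.
by apply: (card_le_I1 (ply1.1 r)); [exists a|exists b].
Qed.

(** The edge is no longer than [a] or [b], yet disjointness makes it at least their mean. *)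
Lemma ply1_longest_edge_adj u v a b : adj G u v ->
  longest_edge G d u a -> longest_edge G d v b -> a = b /\ edist (d u) (d v) = a.
Proof.
move=> uv ua vb.
have := ply1_separated (adj_neq uv) ua vb; have := ua.2 _ uv.
have := vb.2 _ (adj_sym uv); rewrite edistC => ? ? ?.
by split; lra.
Qed.

Hypothesis V_fin : finite_set [set: V].

Lemma exists_longest_edge v w : adj G v w -> exists l, longest_edge G d v l.
Proof.
move=> vw; have [||x vx xmax] := @finite_set_argmax R V [set x | adj G v x]
  (fun x => edist (d v) (d x)).
- by apply: sub_finite_set V_fin.
- by exists w.
by exists (edist (d v) (d x)); split=> //; exists x.
Qed.

Lemma ply1_square_empty_ply :
  exists d' : V -> R * R, drawing d' /\ empty_ply (square G) d'.
Proof.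
(* The second alternative keeps the isolated vertices at their scale and in a
   class of their own. *)
have /choice[l lP] v :
    exists l, longest_edge G d v l \/ (l = 0 /\ forall w, ~ adj G v w).
  have [[w vw]|iso] := pselect (exists w, adj G v w).
    by have [a va] := exists_longest_edge vw; exists a; left.
  by exists 0; right; split=> // w vw; apply: iso; exists w.
have l_long v w : adj G v w -> longest_edge G d v (l v).
  by case: (lP v) => // -[_ iso] /iso.
have l_gt0 v : l v != 0 -> longest_edge G d v (l v).
  by case: (lP v) => // -[-> _]; rewrite eqxx.
pose s v := if l v == 0 then 1 else (l v)^-1.
have s_gt0 v : 0 < s v.
  rewrite /s; case: eqVneq => // /l_gt0 /longest_edge_gt0 lv.
  by rewrite invr_gt0.
pose h uv := (1 + `|s uv.1 * (d uv.1).1 - s uv.2 * (d uv.2).1|)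
               / `|l uv.1 - l uv.2|.
have [K hK] : exists K, forall u v, h (u, v) <= K.
  have [[v0]|V0] := pselect (exists v : V, True); last first.
    by exists 0 => u; case: V0; exists u.
  have [||x _ xmax] := @finite_set_argmax R _ ([set: V] `*` [set: V]) h.
  - exact: finite_setX.
  - by exists (v0, v0).
  by exists (h x) => u v; exact: xmax.
pose d' v := (s v * (d v).1 + K * l v, s v * (d v).2 + 0).
have d'_same u v : l u = l v -> edist (d' u) (d' v) = s u * edist (d u) (d v).
  by move=> luv; rewrite -(edist_affine (K * l u) 0) ?ltW // /d' /s luv.
have d'_far u v : l u != l v -> 1 <= edist (d' u) (d' v).
  rewrite -subr_eq0 -normr_gt0 => luv.
  apply: le_trans (ge_edist1 _ _) => /=.
  have := hK u v; rewrite /h /= ler_pdivrMr //.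
  set x := s u * _; set y := s v * _; set m := l u - l v => hKuv.
  (* The shift [K * m] outweighs the offset [x - y] by at least 1. *)
  have -> : x + K * l u - (y + K * l v) = K * m + (x - y) by rewrite /m; ring.
  have := lerB_normD (K * m) (x - y); rewrite normrM.
  have : K * `|m| <= `|K| * `|m| by rewrite ler_pM2r // ler_norm.
  lra.
have d'_le1 u v : adj G u v -> edist (d' u) (d' v) <= 1.
  move=> uv; have lu := l_long _ _ uv; have lv := l_long _ _ (adj_sym uv).
  have [luv duv] := ply1_longest_edge_adj uv lu lv.
  have lu0 := longest_edge_gt0 lu.
  by rewrite d'_same // /s gt_eqF // duv mulVf ?gt_eqF.
exists d'; split=> [u v /(congr1 (edist (d' u))) |v w wv].
  rewrite edistxx => /esym d0; have [luv|luv] := eqVneq (l u) (l v); last first.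
    by have := d'_far _ _ luv; rewrite d0 ler10.
  apply: contrapT => uv; have duv : d u <> d v by move=> /d_inj.
  have := mulr_gt0 (s_gt0 u) (edist_gt0 duv).
  by rewrite -d'_same // d0 ltxx.
move=> /(square_ply_disk d'_le1)[lt1 [x vx]].
have [lvw|lvw] := eqVneq (l v) (l w); last first.
  by have := d'_far _ _ lvw; lra.
have lv := l_long _ _ vx; have lv0 := longest_edge_gt0 lv.
(* Sharing the positive value [l v], the vertex [w] is not isolated, so the disks of [v] and [w] in
   [d] are disjoint. *)
have lw : longest_edge G d w (l w) by apply: l_gt0; rewrite -lvw gt_eqF.
have := ply1_separated (nesym wv) lv lw.
rewrite -lvw; move: lt1; rewrite d'_same // /s gt_eqF //.
by rewrite ltr_pdivrMl // mulr1; lra.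
Qed.

End PlyOne.

(** * Subgraphs of the triangular tiling *)

Section TriangularLattice.
Variable R : realType.
Implicit Types x y : int * int.

Lemma tri_edist_sqr x y : edist (tri_pos R x) (tri_pos R y) ^+ 2 =
  ((x.1 - y.1) ^+ 2 + (x.1 - y.1) * (x.2 - y.2) + (x.2 - y.2) ^+ 2)%:~R.
Proof.
rewrite edist_sqr /=.
have s3 : Num.sqrt 3 ^+ 2 = 3 :> R by rewrite sqr_sqrtr.
rewrite -mulrBl exprMn expr_div_n s3.
by rewrite !(intrD, intrM, rmorphXn, rmorphB) /=; field.
Qed.

(** The form is integral, and positive definite since four times it is
    [(2 * a + b) ^+ 2 + 3 * b ^+ 2]. *)
Lemma eisenstein_norm_ge1 (a b : int) :
  (a, b) <> (0, 0) -> 1 <= a ^+ 2 + a * b + b ^+ 2.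
Proof.
move=> ab; have [b0|b0] := eqVneq b 0.
  by have : a != 0; [apply/eqP => a0; apply: ab; rewrite a0 b0|subst b; nia].
by nia.
Qed.

Lemma tri_edist_ge1 x y : x <> y -> 1 <= edist (tri_pos R x) (tri_pos R y).
Proof.
case: x y => [x1 x2] [y1 y2] xy.
rewrite -ler_sqr ?nnegrE ?edist_ge0 // expr1n tri_edist_sqr ler1z /=.
by apply: eisenstein_norm_ge1 => -[? ?]; apply: xy; congr pair; lia.
Qed.

(** The difference is twice a nonzero lattice vector. *)
Lemma tri_edist_ge2 x y : x <> y ->
  (x.1 = y.1 %[mod 2])%Z -> (x.2 = y.2 %[mod 2])%Z ->
  2 <= edist (tri_pos R x) (tri_pos R y).
Proof.
case: x y => [x1 x2] [y1 y2] xy /= e1 e2.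
have [a ea] : exists a, x1 - y1 = 2 * a by exists ((x1 %/ 2)%Z - (y1 %/ 2)%Z); lia.
have [b eb] : exists b, x2 - y2 = 2 * b by exists ((x2 %/ 2)%Z - (y2 %/ 2)%Z); lia.
rewrite -ler_sqr ?nnegrE ?edist_ge0 // tri_edist_sqr /= ea eb.
rewrite (_ : 2 ^+ 2 = 4%:~R :> R); last by ring.
rewrite ler_int; have : 1 <= a ^+ 2 + a * b + b ^+ 2.
  by apply: eisenstein_norm_ge1 => -[? ?]; apply: xy; congr pair; lia.
by lia.
Qed.

Lemma tri_square_empty_ply (V : Type) (G : sgraph V) :
  subgraph G triangular_tiling ->
  exists d : V -> R * R, drawing d /\ empty_ply (square G) d /\
    exists k : nat, (k <= 4)%N /\ has_ply (square G) d k.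
Proof.
move=> [f [f_inj f_adj]]; pose d v := tri_pos R (f v); exists d.
have d_le1 u v : adj G u v -> edist (d u) (d v) <= 1.
  by move=> /f_adj /(tri_adjE R) ->.
have d_ge1 u v : u <> v -> 1 <= edist (d u) (d v).
  by move=> uv; apply: tri_edist_ge1 => /f_inj.
split; [|split].
- move=> u v uv; apply: contrapT => /d_ge1.
  by rewrite uv edistxx; lra.
- move=> v w wv /(square_ply_disk d_le1)[+ _].
  by have := d_ge1 _ _ (nesym wv); lra.
suff le4 p : (disks_at (square G) d p #<= `I_4)%card.
  by have [k k4 kply] := has_ply_le le4; exists k.
(* The two parities, read as binary digits, number the four classes from 0 to 3. *)
pose c v := absz (((f v).1 %% 2)%Z + 2 * ((f v).2 %% 2)%Z).
apply: (@card_le_inj _ _ _ _ c) => [u v|v _]; last by rewrite /c /=; lia.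
rewrite !inE => /(square_ply_disk d_le1)[up _].
move=> /(square_ply_disk d_le1)[vp _] cuv.
apply: contrapT => uv.
(* Both centers are at distance less than 1 from [p], hence less than 2 apart. *)
have : 2 <= edist (d u) (d v).
  by apply: tri_edist_ge2 => [/f_inj //| |]; move: cuv; rewrite /c; lia.
have := edist_triangle (d u) p (d v); rewrite (edistC p); lra.
Qed.

End TriangularLattice.

Theorem theorem9 (R : realType) (V : Type) (G : sgraph V) :
  (finite_set [set: V] ->
   (exists d : V -> R * R, drawing d /\ has_ply G d 1) ->
   exists d : V -> R * R, drawing d /\ empty_ply (square G) d)
  /\
  (subgraph G triangular_tiling ->
   exists d : V -> R * R,
     drawing d /\ empty_ply (square G) d /\
     exists k : nat, (k <= 4)%N /\ has_ply (square G) d k).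
Proof.
split=> [V_fin [d [d_inj ply1]]|]; last exact: tri_square_empty_ply.
exact: ply1_square_empty_ply d_inj ply1 V_fin.
Qed.
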